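(* Let $\mathbb{F}$ be a field of characteristic zero. Let $P \in \mathbb{F}[x_1,\dots,x_n, y]$ be a nonzero polynomial of degree at most $r$ that can be computed by an arithmetic circuit of size $s$ and depth at most $\Delta$. Let $f\in \mathbb{F}[x_1,\dots,x_n]$ be a polynomial of degree at most $d$ such that $P(x_1,\dots,x_n, f(x_1,\dots,x_n)) = 0$. Then $f$ can be computed by an arithmetic circuit of depth at most $\Delta + 3$ and size at most $O((srn)^{10}\cdot d^{O(\sqrt{d})})$.
   Context: An arithmetic circuit is a directed acyclic graph whose in-degree-zero nodes are labeled by field elements or variables and whose internal nodes are sum or product gates of unbounded fan-in; it computes polynomials in the natural way. Size is the number of wires; depth is the length of a longest path from an output to an input. Circuits are layered with alternating layers of sum and product gates, the top layer consisting of sum gates. *)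

(* Defs.v *)
From HB Require Import structures.
From mathcomp Require Import all_boot all_order all_algebra.
From mathcomp.multinomials Require Export mpoly.

Set Implicit Arguments.
Unset Strict Implicit.
Unset Printing Implicit Defensive.

Import GRing.Theory.
Local Open Scope ring_scope.

Variant label (F : fieldType) (m : nat) :=
  | LConst of F
  | LVar of 'I_m
  | LSum
  | LProd.
Arguments LConst {F m}.
Arguments LVar {F m}.
Arguments LSum {F m}.
Arguments LProd {F m}.

Definition is_input (F : fieldType) (m : nat) (l : label F m) : bool :=
  match l with LConst _ | LVar _ => true | LSum | LProd => false end.

(* [cfanin x] lists the tails of the wires entering [x]; a node occurring k
   times in it is joined to [x] by k parallel wires.  Wires carry no scalars.
   Layers are numbered downwards from the output: sum gates sit on even layers,
   product gates on odd ones, and wires between gates join consecutive layers.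
   Inputs are not assigned to a layer and may feed any gate. *)
Record circuit (F : fieldType) (m : nat) := Circuit {
  cnode : finType;
  clabel : cnode -> label F m;
  cfanin : cnode -> seq cnode;
  cout : cnode;
  c_input : forall x, nilp (cfanin x) = is_input (clabel x);
  c_acyclic : forall x y, y \in cfanin x -> ~~ connect (grel cfanin) y x;
  c_layered : exists layer : cnode -> nat,
    [/\ layer cout = 0%N,
        forall x, clabel x = LSum -> ~~ odd (layer x),
        forall x, clabel x = LProd -> odd (layer x) &
        forall x y, y \in cfanin x -> ~~ is_input (clabel y) ->
          layer y = (layer x).+1];
  c_top : clabel cout = LSum
}.

Definition csize (F : fieldType) (m : nat) (c : circuit F m) : nat :=
  (\sum_(x : cnode c) size (cfanin x))%N.

(* [path] walks along wires backwards, from the output towards the inputs. *)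
Definition depth_at_most (F : fieldType) (m : nat) (c : circuit F m)
    (D : nat) : Prop :=
  forall p : seq (cnode c),
    path (grel (@cfanin F m c)) (cout c) p ->
    is_input (clabel (last (cout c) p)) -> (size p <= D)%N.

Definition gate_value (F : fieldType) (m : nat) (c : circuit F m)
    (v : cnode c -> {mpoly F[m]}) (x : cnode c) : {mpoly F[m]} :=
  match clabel x with
  | LConst a => a%:MP
  | LVar i => 'X_i
  | LSum => \sum_(y <- cfanin x) v y
  | LProd => \prod_(y <- cfanin x) v y
  end.

(* By acyclicity there is exactly one such [v]: see [valuation_unique] and
   [valuation_exists] below. *)
Definition valuation (F : fieldType) (m : nat) (c : circuit F m)
    (v : cnode c -> {mpoly F[m]}) : Prop :=
  forall x, v x = gate_value v x.

Definition computes (F : fieldType) (m : nat) (c : circuit F m)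
    (p : {mpoly F[m]}) : Prop :=
  exists2 v : cnode c -> {mpoly F[m]}, valuation v & v (cout c) = p.

(* e(d) = O(sqrt d), i.e. e(d) <= k * sqrt d for some constant k. *)
Definition bigO_sqrt (e : nat -> nat) : Prop :=
  exists k : nat, forall d : nat, (e d ^ 2 <= k ^ 2 * d)%N.

Section Valuation.
Variables (F : fieldType) (m : nat) (c : circuit F m).
Local Notation e := (grel (@cfanin F m c)).
Implicit Types v w : cnode c -> {mpoly F[m]}.

Lemma circuit_path_uniq x p : path e x p -> uniq (x :: p).
Proof.
elim: p x => [|y p IH] x //= /andP[xy yp].
have /= -> := IH _ yp; rewrite andbT.
apply/negP => xyp; have := c_acyclic xy; apply/negP; rewrite negbK.
by apply: (path_connect yp).
Qed.

Lemma eq_gate_value v w x :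
  {in cfanin x, v =1 w} -> gate_value v x = gate_value w x.
Proof.
by move=> vw; rewrite /gate_value; case: (clabel x) => //; exact: eq_big_seq.
Qed.

Lemma circuit_ind (Q : cnode c -> Prop) :
  (forall x, {in cfanin x, forall y, Q y} -> Q x) -> forall x, Q x.
Proof.
move=> H x.
have: forall p, path e x p -> (size p < #|cnode c|)%N.
  by move=> p /circuit_path_uniq/card_uniqP Ep; rewrite -[_.+1]Ep max_card.
elim: #|_| x => [|k IH] x Hx; first by have := Hx [::] isT.
apply: H => y xy; apply: IH => p yp.
by apply: (Hx (y :: p)); rewrite /= xy.
Qed.

Lemma valuation_unique v w : valuation v -> valuation w -> v =1 w.
Proof.
move=> Hv Hw; apply: circuit_ind => x IH.
by rewrite Hv Hw; exact: eq_gate_value.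
Qed.

Lemma valuation_exists : exists v, valuation v.
Proof.
pose ev k := iter k (@gate_value F m c) (fun=> 0).
have stable k x : (forall p, path e x p -> (size p < k)%N) ->
    ev k x = ev k.+1 x.
  elim: k x => [|k IH] x Hx; first by have := Hx [::] isT.
  apply: eq_gate_value => y xy; apply: IH => p yp.
  by apply: (Hx (y :: p)); rewrite /= xy.
exists (ev #|cnode c|) => x; apply: stable => p.
by move=> /circuit_path_uniq/card_uniqP Ep; rewrite -[_.+1]Ep max_card.
Qed.

End Valuation.

(* Main.v *)
Require Import Defs.
From HB Require Import structures.
From mathcomp Require Import all_boot all_order all_algebra.
From mathcomp Require Import zify ring.

(**
  Differentiating [P] in [y], we may assume that [f] is a simple root: [Q(x,f) = 0]
  and [q := (dQ/dy)(a, f(a)) <> 0] for some point [a].  Put [y0 := f(a)],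
  [g(t) := f(a + t (x - a)) - y0] and
  [phi(z) := z - Q(a + t (x - a), y0 + z) / q].  Then [g] is a fixed point of
  [phi] and, modulo [t], it vanishes while [phi] is divisible by [z^2]; hence
  Lagrange inversion gives [g = sum_m (1/m) [z^(m-1)] phi(z)^m], where only the
  terms with [m <= 2 d + O(1)] contribute modulo [t^(d+1)].  Since
  [f = y0 + g(1)] and [g] has degree at most [d] in [t], interpolation in [z]
  and [t] (and in [y], to express [Q] through [P]) writes [f] as a linear
  combination of powers of linear combinations of polynomials
  [P(l x + (1 - l) a, j)] with [l] and [j] natural numbers.  This is a circuit
  of depth [Delta + 3] and of size polynomial in [s], [r] and [d]: the exponent
  of [d] is bounded, and no depth reduction is needed.
*)

Set Implicit Arguments.
Unset Strict Implicit.
Unset Printing Implicit Defensive.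

Import GRing.Theory.
Local Open Scope ring_scope.

(** * Lagrange inversion *)

Lemma telescope_ord (V : zmodType) (u w : nat -> V) N :
  (forall m, u m = w m - w m.+1) -> \sum_(m < N) u m = w 0%N - w N.
Proof.
move=> uw; rewrite (eq_bigr (fun m : 'I_N => w m - w m.+1)) //.
elim: N => [|N IH]; first by rewrite big_ord0 subrr.
by rewrite big_ord_recr IH /= addrA subrK.
Qed.

Section LagrangeInversion.
Variables (F : fieldType) (A : comNzRingType) (iota : {rmorphism F -> A}).
Hypothesis char0 : [pchar F] =i pred0.
Implicit Types (p q h : {poly {poly A}}) (u v : {poly A}).

(* The variable [t] of the coefficients has weight 2 and the outer variable [z]
   has weight 1. *)
Definition wge k p := forall i a, (2 * a + i < k)%N -> p`_i`_a = 0.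
Definition ordge k u := forall a, (a < k)%N -> u`_a = 0.

Lemma ordgeD k u v : ordge k u -> ordge k v -> ordge k (u + v).
Proof. by move=> hu hv a ak; rewrite coefD hu // hv // addr0. Qed.

Lemma ordgeN k u : ordge k u -> ordge k (- u).
Proof. by move=> hu a ak; rewrite coefN hu // oppr0. Qed.

Lemma ordgeM k u v : ordge k u -> ordge k (u * v).
Proof.
move=> hu a ak; rewrite coefM big1 // => j _.
by rewrite hu ?mul0r // (leq_ltn_trans _ ak) // -ltnS.
Qed.

Lemma wge_mul k l p q : wge k p -> wge l q -> wge (k + l) (p * q).
Proof.
move=> hp hq i a lt_kl; rewrite coefM coef_sum big1 // => -[j /= lt_j] _.
rewrite coefM big1 // => -[b /= lt_b] _.
have [lt_k|ge_k] := ltnP (2 * b + j) k; first by rewrite hp // mul0r.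
by rewrite [q`_ _`__]hq ?mulr0 //; lia.
Qed.

Lemma wge_exp k p m : wge k p -> wge (m * k) (p ^+ m).
Proof.
by move=> hp; elim: m => [|m IH]; rewrite ?expr0 // exprS mulSn; apply: wge_mul.
Qed.

Lemma natr_iotaV m : iota (m.+1%:R^-1) * m.+1%:R = 1.
Proof.
rewrite -(rmorph_nat iota) -rmorphM mulVf ?rmorph1 //.
by move/pcharf0P: char0 => ->.
Qed.

Variables (d : nat) (phi : {poly {poly A}}) (g : {poly A}).
Hypothesis phi_w : wge 2 phi.
Hypothesis phi_fix : phi.[g] = g.
Hypothesis g_ord : ordge 1 g.

(* Formally [Lambda h] is the residue at [z = 0] of [h / (z - phi)]. *)
Definition Lambda h : {poly A} := \sum_(m < (2 * d).+2) (h * phi ^+ m)`_m.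

Lemma LambdaD h1 h2 : Lambda (h1 + h2) = Lambda h1 + Lambda h2.
Proof.
by rewrite /Lambda -big_split; apply: eq_bigr => m _; rewrite mulrDl coefD.
Qed.

Lemma LambdaC u h : Lambda (u%:P * h) = u * Lambda h.
Proof.
by rewrite /Lambda mulr_sumr; apply: eq_bigr => m _; rewrite -mulrA coefCM.
Qed.

(** Each factor [phi] brings weight 2, while extracting the coefficient of z^m takes away only m; a
    weight of at least k + m is left to powers of t, which have weight 2. *)
Lemma ordge_coef_phi k h m : wge k h ->
  (2 * d < k + m)%N -> ordge d.+1 (h * phi ^+ m)`_m.
Proof.
move=> hh le_d a le_a; apply: (@wge_mul k (m * 2)) => //; first exact: wge_exp.
by lia.
Qed.

Lemma ordge_Lambda h : wge (2 * d).+1 h -> ordge d.+1 (Lambda h).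
Proof.
move=> hh; apply: (big_ind (ordge d.+1)).
- by move=> a _; rewrite coef0.
- exact: ordgeD.
by move=> m _; apply: (ordge_coef_phi hh); lia.
Qed.

(** A factor z - [phi] makes the sum telescope. The first term vanishes because its factor z leaves
    no constant coefficient, and the last one has too high an order in t. *)
Lemma ordge_Lambda_phi h : ordge d.+1 (Lambda (('X - phi) * h)).
Proof.
rewrite /Lambda (@telescope_ord _ (fun m => (('X - phi) * h * phi ^+ m)`_m)
  (fun m => ('X * h * phi ^+ m)`_m)).
  rewrite expr0 mulr1 coefXM /= sub0r; apply: ordgeN.
  by apply: (@ordge_coef_phi 0) => //; lia.
move=> m; rewrite -!mulrA mulrBl coefB; congr (_ - _).
by rewrite [in RHS]coefXM /= exprS; congr (nth _ (polyseq _) _); ring.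
Qed.

(* [z - phi = (z - g) (1 - psi)] with [psi] topologically nilpotent. *)
Lemma psi_exists : exists2 psi, 'X - phi = (1 - psi) * ('X - g%:P) & wge 1 psi.
Proof.
have /factor_theorem [theta th] : root ('X - phi) g.
  by rewrite rootE hornerD hornerN hornerX phi_fix subrr.
exists (1 - theta); first by rewrite subKr.
move=> i a; rewrite ltnS leqn0 addn_eq0 muln_eq0 /= => /andP[/eqP-> /eqP->].
(* The only coefficient of weight 0 sits at z^0 t^0; comparing the coefficients of z t^0 shows that
   it equals 1 in [theta]. *)
have := congr1 (fun p : {poly {poly A}} => p`_1`_0) th.
rewrite /= mulrBr !coefB coefX coefMX /= coefMC [phi`_1`_0]phi_w // subr0.
by rewrite coef0M g_ord // mulr0 subr0 !coef1 /= => ->; rewrite subrr.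
Qed.

Lemma ordge_Lambda_g h : ordge d.+1 (Lambda (('X - g%:P) * h)).
Proof.
have [psi def_psi psi_w] := psi_exists.
(* Since z - g = (z - [phi]) + [psi] (z - g), each round replaces the multiplier [h'] by [psi * h'],
   of weight one more; [N] rounds bring the weight above 2d. *)
suff H N k h' : wge k h' -> (2 * d < k + N)%N ->
    ordge d.+1 (Lambda (('X - g%:P) * h')).
  by apply: (H (2 * d).+1 0%N); rewrite ?add0n.
elim: N k h' => [|N IH] k h' hh kN.
  apply: ordge_Lambda; rewrite addn0 in kN => i a ia.
  by apply: (@wge_mul 0 k) => //; lia.
have -> : ('X - g%:P) * h' = ('X - phi) * h' + ('X - g%:P) * (psi * h').
  by rewrite def_psi; ring.
rewrite LambdaD; apply: ordgeD; first exact: ordge_Lambda_phi.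
by apply: (IH (1 + k)%N); [apply: wge_mul | lia].
Qed.

(** The difference of [h] and the constant [h.[g]] is a multiple of z - g, which [Lambda] sends to 0
    modulo t^(d+1). *)
Lemma Lambda_horner h : ordge d.+1 (Lambda h - h.[g] * Lambda 1).
Proof.
have /factor_theorem [q hq] : root (h - h.[g]%:P) g.
  by rewrite rootE hornerD hornerN hornerC subrr.
have -> : Lambda h - h.[g] * Lambda 1 = Lambda (('X - g%:P) * q).
  rewrite [('X - _) * q]mulrC -hq LambdaD -polyCN -[(- _)%:P]mulr1 LambdaC.
  by rewrite mulNr.
exact: ordge_Lambda_g.
Qed.

(** Both sides are the coefficient of z^j in the derivative of [phi ^+ m.+1]. *)
Lemma coef_phi_deriv m j :
  (phi^`() * phi ^+ m)`_j * m.+1%:R = (phi ^+ m.+1)`_j.+1 * j.+1%:R.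
Proof.
by rewrite !mulr_natr -coef_deriv deriv_exp /= mulrC -coefMn; congr (nth _ (polyseq _) _).
Qed.

(** [A] may have zero divisors, so the cancellation uses the inverse of m + 1 in [F]. *)
Lemma mulr_natS_inj m u v : u * m.+1%:R = v * m.+1%:R -> u = v.
Proof.
have H w : w = w * m.+1%:R * (iota (m.+1%:R^-1))%:P.
  rewrite -mulrA -polyC_natr -polyCM [X in _ * X%:P]mulrC.
  by rewrite natr_iotaV mulr1.
by move=> uv; rewrite (H u) uv -H.
Qed.

(** This is the residue of the logarithmic derivative of z - [phi], which has the simple root [g].
    Formally, [coef_phi_deriv] with j = m makes the sum telescope from 1. *)
Lemma Lambda_deriv : ordge d.+1 (Lambda (1 - phi^`()) - 1).
Proof.
rewrite /Lambda (@telescope_ord _ (fun m => ((1 - phi^`()) * phi ^+ m)`_m)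
  (fun m => (phi ^+ m)`_m)).
  rewrite expr0 coef1 /= addrAC subrr sub0r; apply: ordgeN.
  by rewrite -[phi ^+ _]mul1r; apply: (@ordge_coef_phi 0) => //; lia.
move=> m; rewrite mulrBl mul1r coefB; congr (_ - _).
by apply: (@mulr_natS_inj m); rewrite coef_phi_deriv.
Qed.

(** The residue of z times the logarithmic derivative of z - [phi] is the root [g]; the formula is
    its expansion. *)
Theorem lagrange_inversion : exists c : nat -> F, ordge d.+1
  (g - \sum_(m < (2 * d).+3) (iota (c m))%:P * (phi ^+ m.+1)`_m).
Proof.
pose w m := (phi ^+ m.+1)`_m.
pose e m : F := m%:R / m.+1%:R.
have Lam : Lambda ('X * (1 - phi^`())) =
    \sum_(m < (2 * d).+1) w m - \sum_(m < (2 * d).+2) (iota (e m))%:P * w m.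
  have -> : \sum_(m < (2 * d).+1) w m =
      \sum_(m < (2 * d).+2) ('X * phi ^+ m)`_m.
    rewrite [RHS]big_ord_recl expr0 mulr1 coefX add0r.
    by apply: eq_bigr => m _; rewrite coefXM.
  rewrite -sumrB; apply: eq_bigr => m _.
  rewrite mulrBr mulr1 mulrBl coefB; congr (_ - _).
  apply: (@mulr_natS_inj m); rewrite -['X * _ * _]mulrA coefXM.
  case: (nat_of_ord m) => [|k] /=; first by rewrite /e !mul0r rmorph0 !mul0r.
  rewrite coef_phi_deriv /w mulrAC -polyC_natr -polyCM -!(rmorph_nat iota).
  rewrite -rmorphM divfK ?rmorph_nat ?polyC_natr 1?mulrC //.
  by move/pcharf0P: char0 => ->.
(* The two sums of [Lam] stop at different indices, hence the indicators; for m at most 2d the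
   coefficient is the classical 1 / (m + 1). *)
exists (fun m => (m < (2 * d).+1)%:R - (m < (2 * d).+2)%:R * e m).
set S := \sum_(m < _) _.
have -> : S = Lambda ('X * (1 - phi^`())).
  rewrite Lam /S; under eq_bigr do rewrite rmorphB rmorphM !rmorph_nat
    polyCB polyCM mulrBl !polyC_natr.
  rewrite sumrB; congr (_ - _).
    rewrite 2!big_ord_recr /= ltnn ltnNge leqnSn /= !mul0r !addr0.
    by apply: eq_bigr => m _; rewrite ltn_ord mul1r.
  rewrite big_ord_recr /= ltnn !mul0r addr0.
  by apply: eq_bigr => m _; rewrite ltn_ord mul1r.
(* Modulo t^(d+1), [Lambda ('X * (1 - phi^]()))[is g (1 - phi'(g))]Lambda 1[, that is g]Lambda (1 -
   phi^[())], that is g; the three summands are the three errors. *)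
have -> : g - Lambda ('X * (1 - phi^`())) =
   - (Lambda (1 - phi^`()) - 1) * g
   + (Lambda (1 - phi^`()) - (1 - phi^`()).[g] * Lambda 1) * g
   - (Lambda ('X * (1 - phi^`())) - ('X * (1 - phi^`())).[g] * Lambda 1).
  by rewrite hornerM hornerX; ring.
apply: ordgeD; last by apply: ordgeN; apply: Lambda_horner.
apply: ordgeD; apply: ordgeM; last exact: Lambda_horner.
by apply: ordgeN; apply: Lambda_deriv.
Qed.

End LagrangeInversion.

(** * Interpolation *)

(** The nodes 0, ..., D - 1 are distinct in characteristic zero, so their Vandermonde matrix is
    invertible. The weights lie in [F] and precede [A], so the same ones serve several rings. *)
Lemma interpolation (F : fieldType) (D : nat) : [pchar F] =i pred0 ->
  exists c : nat -> nat -> F,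
  forall (A : comNzRingType) (iota : {rmorphism F -> A}) (p : {poly A}) i,
    (size p <= D)%N -> (i < D)%N ->
    p`_i = \sum_(k < D) iota (c i k) * p.[k%:R].
Proof.
case: D => [|D] char0; first by exists (fun=> fun=> 0).
pose V : 'M[F]_D.+1 := Vandermonde D.+1 (\row_k k%:R).
have Vu : V \in unitmx.
  rewrite unitmxE det_Vandermonde unitfE; apply/prodf_neq0 => a _.
  apply/prodf_neq0 => b ab; rewrite !mxE -natrB; last exact: ltnW.
  by move/pcharf0P: char0 => ->; rewrite subn_eq0 -ltnNge.
exists (fun i k => invmx V (inord k) (inord i)) => A iota p i sp iD.
have pE x : p.[x] = \sum_(j < D.+1) p`_j * x ^+ j by exact: horner_coef_wide.
under eq_bigr => k _ do rewrite pE mulr_sumr inord_val.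
rewrite exchange_big /=.
have H (j : 'I_D.+1) :
    \sum_(k < D.+1) iota (invmx V k (inord i)) * (p`_j * k%:R ^+ j)
    = p`_j * iota (j == i :> nat)%:R.
  have := congr1 (fun M : 'M_ _ => M j (inord i)) (mulmxV Vu).
  rewrite !mxE -(inj_eq val_inj) /= inordK // => <-.
  rewrite rmorph_sum mulr_sumr; apply: eq_bigr => k _.
  by rewrite rmorphM !mxE rmorphXn rmorph_nat; ring.
under eq_bigr do rewrite H.
rewrite (bigD1 (Ordinal iD)) //= eqxx rmorph1 mulr1 big1 ?addr0 // => j.
by rewrite -(inj_eq val_inj) /= => /negbTE ->; rewrite rmorph0 mulr0.
Qed.

Lemma horner_derivn (A : comNzRingType) (p : {poly A}) R j x :
  (size p <= R)%N ->
  p^`(j).[x] = \sum_(i < R) p`_i * (x ^+ (i - j) *+ i ^_ j).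
Proof.
move=> pR; rewrite -{1}(coefK p) poly_def.
rewrite (big_ord_widen R (fun i => p`_i *: 'X^i)) // big_mkcond /=.
rewrite raddf_sum /= horner_sum; apply: eq_bigr => i _.
case: ltnP => ip; last by rewrite derivnC if_same horner0 nth_default ?mul0r.
by rewrite derivnZ hornerZ derivnXn hornerMn hornerXn.
Qed.

(** A value of a derivative is linear in the coefficients, hence in the values at natural numbers:
    no circuit for the derivative itself is built. *)
Lemma derivn_interpolation (F : fieldType) R j : [pchar F] =i pred0 ->
  exists c : F -> nat -> F,
  forall (A : comNzRingType) (iota : {rmorphism F -> A}) (p : {poly A}) x,
    (size p <= R)%N ->
    p^`(j).[iota x] = \sum_(k < R) iota (c x k) * p.[k%:R].
Proof.
move=> char0; have [c cP] := interpolation R char0.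
exists (fun x k => \sum_(i < R) c i k * (x ^+ (i - j) *+ i ^_ j)).
move=> A iota p x pR; rewrite (horner_derivn _ _ pR).
under [LHS]eq_bigr => i _ do rewrite (cP _ iota p i pR) // mulr_suml.
rewrite exchange_big /=; apply: eq_bigr => k _.
rewrite rmorph_sum mulr_suml; apply: eq_bigr => i _.
by rewrite rmorphM rmorphMn rmorphXn; ring.
Qed.

(** * Layered networks *)

Definition gate_op {R : comNzRingType} (b : bool) (s : seq R) : R :=
  if b then \prod_(y <- s) y else \sum_(y <- s) y.

Lemma gate_op_cat (R : comNzRingType) b (s t : seq R) :
  gate_op b (s ++ t) = gate_op b [:: gate_op b s; gate_op b t].
Proof. by case: b; rewrite /gate_op big_cat /= !big_cons big_nil ?mulr1 ?addr0. Qed.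

Lemma gate_op1 (R : comNzRingType) b (x : R) : gate_op b [:: x] = x.
Proof. by case: b; rewrite /gate_op big_seq1. Qed.

Section Nets.
Variables (F : fieldType) (m : nat).
Implicit Types (l : F + 'I_m) (b : bool) (p q : {mpoly F[m]}).

(* A circuit whose inputs are not nodes: a gate lists its inputs directly. A
   gate without children is the empty sum or product, hence a constant. *)
Record net := Net {
  gate : finType;
  level : gate -> nat;
  children : gate -> seq (gate + (F + 'I_m));
  root : gate;
  level_root : level root = 0%N;
  level_child : forall x y, inl y \in children x -> level y = (level x).+1
}.

Definition leaf_val l : {mpoly F[m]} :=
  match l with inl a => a%:MP | inr i => 'X_i end.

Definition child_val (G : Type) (v : G -> {mpoly F[m]}) (c : G + (F + 'I_m)) :=
  match c with inl x => v x | inr l => leaf_val l end.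

(* [b] tells whether the root is a product gate. *)
Definition net_valuation b (N : net) (v : gate N -> {mpoly F[m]}) :=
  forall x, v x = gate_op (b (+) odd (level x)) (map (child_val v) (children x)).

Definition net_size (N : net) := (\sum_(x : gate N) size (children x))%N.

(** A childless gate is exempt because it becomes a constant input of the circuit; a gate with
    children must leave room for one more wire. *)
Definition net_depth (N : net) D :=
  forall x : gate N, children x != [::] -> (level x < D)%N.

Definition computable b D S p := exists (N : net) (v : gate N -> {mpoly F[m]}),
  [/\ net_valuation b v, v (root N) = p, net_depth N D & (net_size N <= S)%N].

Lemma computableW b D D' S S' p : (D <= D')%N -> (S <= S')%N ->
  computable b D S p -> computable b D' S' p.
Proof.
move=> hD hS [N [v [vN vp dN sN]]]; exists N, v; split=> //.
  by move=> x /dN/leq_trans; apply.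
exact: leq_trans hS.
Qed.

Section LeafNet.
Variable l : F + 'I_m.
Fact leaf_net_level (x y : unit) :
  inl y \in [:: inr l : unit + (F + 'I_m)] -> 0%N = 1%N.
Proof. by rewrite inE. Qed.
Definition leaf_net :=
  @Net unit (fun=> 0%N) (fun=> [:: inr l]) tt erefl leaf_net_level.
End LeafNet.

Lemma computable_leaf b l : computable b 1 1 (leaf_val l).
Proof.
exists (leaf_net l), (fun=> leaf_val l); split=> //.
- by move=> x; rewrite /= gate_op1.
- by rewrite /net_size big_const card_unit.
Qed.

Definition relabel (G G' : Type) (h : G -> G') (c : G + (F + 'I_m)) :=
  match c with inl x => inl (h x) | inr l => inr l end.

Lemma mem_relabel (G G' : eqType) (h : G -> G') (s : seq (G + (F + 'I_m))) y :
  inl y \in map (relabel h) s -> exists2 x, y = h x & inl x \in s.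
Proof. by case/mapP => -[x|l] // xs [->]; exists x. Qed.

Lemma relabel_val (G G' : eqType) (h : G -> G') v v' s :
  (forall x, inl x \in s -> v' (h x) = v x) ->
  map (child_val v') (map (relabel h) s) = map (child_val v) s.
Proof.
by move=> hv; rewrite -map_comp; apply/eq_in_map => -[x|l] //= /hv.
Qed.

Lemma root_not_child (N : net) (x y : gate N) :
  inl y \in children x -> (y == root N) = false.
Proof.
by move=> /level_child ly; apply/eqP => yr; rewrite yr level_root in ly.
Qed.

Section Merge.
Variables N1 N2 : net.

Definition merge_level (x : gate N1 + gate N2) :=
  match x with inl x => level x | inr x => level x end.

(** The root of [N1] also receives the children of the root of [N2], so that no layer is added. The
    old root of [N2] stays, unreachable; its wires are thus counted twice. *)
Definition merge_children (x : gate N1 + gate N2) :=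
  match x with
  | inl x => map (relabel inl) (children x) ++
      (if x == root N1 then map (relabel inr) (children (root N2)) else [::])
  | inr x => map (relabel inr) (children x)
  end.

Fact merge_level_child x y :
  inl y \in merge_children x -> merge_level y = (merge_level x).+1.
Proof.
case: x => x /=; last by case/mem_relabel => z -> /level_child.
rewrite mem_cat; case/orP => [/mem_relabel [z -> /level_child] //|].
case: eqP => // -> /mem_relabel [z -> /level_child] /=.
by rewrite !level_root.
Qed.

Definition merge := Net (level_root N1 : merge_level (inl _) = _)
  merge_level_child.
End Merge.

Lemma computable_op b D S1 S2 p q :
  computable b D S1 p -> computable b D S2 q ->
  computable b D (S1 + 2 * S2) (gate_op b [:: p; q]).
Proof.
move=> [N1 [v1 [h1 e1 d1 s1]]] [N2 [v2 [h2 e2 d2 s2]]].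
pose v (x : gate (merge N1 N2)) := match x with
  | inl x => if x == root N1 then gate_op b [:: p; q] else v1 x
  | inr x => v2 x end.
have r1 x : map (child_val v) (map (relabel inl) (children x)) =
            map (child_val v1) (children x).
  by apply: relabel_val => y /root_not_child /= ->.
have r2 x : map (child_val v) (map (relabel inr) (children x)) =
            map (child_val v2) (children x).
  exact: relabel_val.
exists (merge N1 N2), v; split.
- case=> x /=; last by rewrite r2 -h2.
  rewrite map_cat r1; case: eqP => [->|_]; last by rewrite cats0 -h1.
  rewrite r2 gate_op_cat level_root addbF -e1 -e2 h1 h2.
  by rewrite !level_root !addbF.
- by rewrite /v /= eqxx.
- case=> x /=; last by rewrite -size_eq0 size_map size_eq0 => /d2.
  case: (x =P root N1) => [->|_]; rewrite -size_eq0 ?cats0 ?size_cat !size_map.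
    rewrite addn_eq0 negb_and !size_eq0 => /orP[/d1 //|/d2].
    by rewrite !level_root.
  by rewrite size_eq0 => /d1.
rewrite /net_size big_sumType /=.
rewrite (eq_bigr (fun x => size (children x) +
  if x == root N1 then size (children (root N2)) else 0)%N); last first.
  by move=> x _; rewrite size_cat size_map; case: ifP; rewrite ?size_map.
rewrite big_split /= -big_mkcond /= big_pred1_eq.
rewrite [X in (_ + X <= _)%N](eq_bigr (fun x => size (children x))); last first.
  by move=> x _; rewrite size_map.
have : (size (children (root N2)) <= net_size N2)%N.
  by rewrite /net_size (bigD1 (root N2)) //= leq_addr.
by move: s1 s2; rewrite /net_size; lia.
Qed.

Lemma computableD D S1 S2 p q :
  computable false D S1 p -> computable false D S2 q ->
  computable false D (S1 + 2 * S2) (p + q).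
Proof.
by move=> cp /(computable_op cp); rewrite /gate_op big_cons big_seq1.
Qed.

Lemma computableM D S1 S2 p q :
  computable true D S1 p -> computable true D S2 q ->
  computable true D (S1 + 2 * S2) (p * q).
Proof.
by move=> cp /(computable_op cp); rewrite /gate_op big_cons big_seq1.
Qed.

Lemma computable_sum_ord D S0 S k p0 (p : 'I_k -> {mpoly F[m]}) :
  computable false D S0 p0 -> (forall i, computable false D S (p i)) ->
  computable false D (S0 + k * (2 * S)) (p0 + \sum_(i < k) p i).
Proof.
move=> c0; elim: k p => [|k IH] p cp; first by rewrite big_ord0 addr0 addn0.
rewrite big_ord_recr addrA mulSn [(2 * S + _)%N]addnC addnA.
by apply: computableD => //; apply: IH.
Qed.

Section Raise.
Variables (N : net) (k : nat).
Definition raise_level (x : unit + gate N) :=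
  if x is inr x then (level x).+1 else 0%N.
(** The [k] parallel wires yield a k-th power at a product gate; [k] = 1 only changes the kind of
    the root. *)
Definition raise_children (x : unit + gate N) :
    seq ((unit + gate N) + (F + 'I_m)) :=
  if x is inr x then map (relabel inr) (children x)
  else nseq k (inl (inr (root N))).
Fact raise_level_child x y :
  inl y \in raise_children x -> raise_level y = (raise_level x).+1.
Proof.
case: x => [x|x] /=; last by case/mem_relabel => z -> /level_child /= ->.
by case/nseqP => -[->] _ /=; rewrite level_root.
Qed.
Definition raise := @Net (unit + gate N)%type raise_level raise_children (inl tt)
  erefl raise_level_child.
End Raise.

Lemma computable_raise b D S k p : computable b D S p ->
  computable (~~ b) D.+1 (S + k) (gate_op (~~ b) (nseq k p)).
Proof.
move=> [N [v [h e d s]]].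
exists (raise N k), (fun x => if x is inr x then v x
                      else gate_op (~~ b) (nseq k p)); split=> //.
- case=> [x|x] /=; first by rewrite addbF map_nseq /= e.
  by rewrite (@relabel_val _ _ inr v) // h addbN addNb negbK.
- by case=> [x|x] //=; rewrite -size_eq0 size_map size_eq0 ltnS => /d.
rewrite /net_size big_sumType /= (big_pred1 tt) ?size_nseq; last by case.
by rewrite addnC leq_add2r; under eq_bigr do rewrite size_map.
Qed.

Lemma computable_exp D S k p :
  computable false D S p -> computable true D.+1 (S + k) (p ^+ k).
Proof.
move=> /(computable_raise k); rewrite /gate_op /= big_nseq.
by rewrite -Monoid.iteropE.
Qed.

Lemma computable_up b D S p :
  computable b D S p -> computable (~~ b) D.+1 S.+1 p.
Proof. by move=> /(computable_raise 1); rewrite addn1 gate_op1. Qed.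

Section Scale.
Variables (a : F) (N : net).
Let K := size (children (root N)).
Definition scale_level (x : gate N + 'I_K) :=
  match x with inl x => level x | inr _ => 1%N end.
(** As wires carry no scalars, each child of the sum root gets its own product gate with the extra
    factor [a]. A child that is a product gate has its children copied into this new gate, so no
    layer is added. *)
Definition scale_children (x : gate N + 'I_K) :
    seq ((gate N + 'I_K) + (F + 'I_m)) :=
  match x with
  | inl x => if x == root N then [seq inl (inr i) | i <- enum 'I_K]
             else map (relabel inl) (children x)
  | inr i => inr (inl a) ::
     match tnth (in_tuple (children (root N))) i with
     | inl y => map (relabel inl) (children y)
     | inr l => [:: inr l]
     end
  end.
Fact scale_level_child x y :
  inl y \in scale_children x -> scale_level y = (scale_level x).+1.
Proof.
case: x => [x|i] /=.
  case: (x =P root N) => [->|_]; last by case/mem_relabel => z -> /level_child.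
  by case/mapP => i _ [->]; rewrite /= level_root.
rewrite inE /=; have := mem_tnth i (in_tuple (children (root N))).
case: (tnth _ i) => [z|l] /=; last by rewrite inE.
move=> /level_child; rewrite level_root => lz.
by case/mem_relabel => u -> /level_child /=; rewrite lz.
Qed.
Definition scale := @Net (gate N + 'I_K)%type scale_level scale_children
  (inl (root N)) (level_root N) scale_level_child.
End Scale.

Lemma computableZ D S a p : (1 < D)%N ->
  computable false D S p -> computable false D (S * S.+2) (a *: p).
Proof.
move=> D2 [N [v [h e d s]]].
pose rc := in_tuple (children (root N)).
pose v' (x : gate (scale a N)) := match x with
  | inl x => if x == root N then a *: p else v x
  | inr i => a%:MP * child_val v (tnth rc i)
  end.
have r x : map (child_val v') (map (relabel inl) (children x)) =
           map (child_val v) (children x).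
  by apply: relabel_val => y /root_not_child /= ->.
exists (scale a N), v'; split.
- case=> [x|i] /=.
    case: (x =P root N) => [->|_]; last by rewrite r -h.
    rewrite level_root /= -map_comp /gate_op big_map -e h level_root /=.
    rewrite /gate_op big_map -mul_mpolyC mulr_sumr.
    by rewrite (big_tnth _ _ (children (root N))) big_enum.
  rewrite /gate_op /= big_cons /=; congr (_ * _).
  have := mem_tnth i rc; rewrite -/rc; case: (tnth _ i) => [z|l] /=; last first.
    by rewrite big_seq1.
  by move=> /level_child lz; rewrite r h lz level_root.
- by rewrite /v' /= eqxx.
- case=> [x|i] //=; case: (x =P root N) => [->|_].
    by rewrite level_root; lia.
  by rewrite -size_eq0 size_map size_eq0 => /d.
rewrite /net_size big_sumType /=.
have le_size (x : gate N) : (size (children x) <= S)%N.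
  by apply: leq_trans s; rewrite /net_size (bigD1 x) //= leq_addr.
(* There are at most S new product gates, each of fan-in at most S + 1. *)
apply: (@leq_trans (S + size rc * S.+1)%N); last first.
  by rewrite [(S * _)%N]mulnS leq_add2l leq_mul2r (le_size (root N)) orbT.
apply: leq_add.
  apply: leq_trans s; apply: leq_sum => x _; case: eqP => [->|_].
    by rewrite size_map size_enum_ord.
  by rewrite size_map.
rewrite -[X in (_ <= X * _)%N]card_ord -sum_nat_const; apply: leq_sum => i _.
rewrite ltnS; have := mem_tnth i rc; rewrite -/rc.
case: (tnth _ i) => [z|l] _ /=; first by rewrite size_map.
by apply: leq_trans (le_size (root N)); apply: leq_ltn_trans (ltn_ord i).
Qed.

End Nets.

(** * Affine substitution into a net *)

Section Substitution.
Variables (F : fieldType) (m n : nat).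
Variables (k : nat) (kappa : 'I_m -> F + 'I_n) (c : 'I_n -> F).

(* Multiples by the natural number [k] are obtained with [k] parallel wires. *)
Definition affine_leaves (l : F + 'I_m) : seq (F + 'I_n) :=
  match l with
  | inl a => [:: inl a]
  | inr i => match kappa i with
             | inl a => [:: inl a]
             | inr j => rcons (nseq k (inr j)) (inl (c j))
             end
  end.

Definition affine_subst (i : 'I_m) : {mpoly F[n]} :=
  match kappa i with inl a => a%:MP | inr j => 'X_j *+ k + (c j)%:MP end.

Local Notation sigma := (mmap (@mpolyC n F) affine_subst).

Lemma affine_leavesE l :
  \sum_(l' <- affine_leaves l) leaf_val l' = sigma (leaf_val l).
Proof.
case: l => [a|i] /=; first by rewrite big_seq1 mmapC.
rewrite mmapX mmap1U /affine_subst; case: (kappa i) => [a|j] /=.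
  by rewrite big_seq1.
by rewrite big_rcons big_nseq /= iter_addr addr0.
Qed.

Lemma size_affine_leaves l : (size (affine_leaves l) <= k.+1)%N.
Proof.
case: l => [a|i] //=; case: (kappa i) => [a|j] //=.
by rewrite size_rcons size_nseq.
Qed.

Section SubstNet.
Variables (b : bool) (N : net F m).
Local Notation isprod x := (b (+) odd (level x)).

Definition subst_level (x : gate N + gate N * 'I_m) :=
  match x with inl x => level x | inr (x, _) => (level x).+1 end.

Definition subst_prod (x : gate N) (u : gate N + (F + 'I_m)) :
    (gate N + gate N * 'I_m) + (F + 'I_n) :=
  match u with
  | inl y => inl (inl y)
  | inr (inl a) => inr (inl a)
  | inr (inr i) => inl (inr (x, i))
  end.

Definition subst_sum (u : gate N + (F + 'I_m)) :
    seq ((gate N + gate N * 'I_m) + (F + 'I_n)) :=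
  match u with
  | inl y => [:: inl (inl y)]
  | inr l => map inr (affine_leaves l)
  end.

(** A sum gate absorbs the affine form of a variable into its own list. A product gate [x] reads
    variable [i] through a new sum gate [(x, i)] one level lower, which costs one unit of depth; the
    pairs that do not occur stay childless. *)
Definition subst_children (x : gate N + gate N * 'I_m) :=
  match x with
  | inl x => if isprod x then map (subst_prod x) (children x)
             else flatten (map subst_sum (children x))
  | inr (x, i) => if isprod x && (inr (inr i) \in children x)
                  then map inr (affine_leaves (inr i)) else [::]
  end.

Fact subst_level_child x y :
  inl y \in subst_children x -> subst_level y = (subst_level x).+1.
Proof.
case: x => [x|[x i]] /=; last by case: ifP => // _ /mapP[].
case: ifP => _.
  by case/mapP => -[z|[a|i]] //= zx [->] //=; apply: level_child.
case/flatten_mapP => -[z|l] /= zx; last by case/mapP.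
by rewrite inE => /eqP[->] /=; apply: level_child.
Qed.

Definition subst_net := @Net F n (gate N + gate N * 'I_m)%type
  subst_level subst_children (inl (root N)) (level_root N) subst_level_child.
End SubstNet.

Lemma computable_subst b D S p : computable b D S p ->
  computable b D.+1 (S * (2 * k.+1)) (sigma p).
Proof.
move=> [N [v [h e d s]]].
pose v' (x : gate (subst_net b N)) := match x with
  | inl x => sigma (v x)
  | inr (x, i) => if (b (+) odd (level x)) && (inr (inr i) \in children x)
                  then affine_subst i else gate_op (~~ (b (+) odd (level x))) [::]
  end.
exists (subst_net b N), v'; split.
- case=> [x|[x i]] /=.
    rewrite h; case: ifP => bx; rewrite /gate_op.
      rewrite !big_map rmorph_prod /=; apply: eq_big_seq => -[y|[a|i]] //= yx.
        by rewrite mmapC.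
      by rewrite mmapX mmap1U bx yx.
    rewrite !big_map rmorph_sum /= big_flatten big_map.
    apply: eq_bigr => -[y|l] _; rewrite ?big_seq1 // big_map.
    exact/esym/affine_leavesE.
  case: ifP => [/andP[bx _]|_]; rewrite /= addbN ?bx //=.
  by rewrite /gate_op !big_map (affine_leavesE (inr i)) /= mmapX mmap1U.
- by rewrite /v' /= e.
- case=> [x|[x i]] /= ne.
    apply/leqW/d; apply: contraNneq ne => ->.
    by case: ifP.
  rewrite ltnS; apply: d; case: ifP ne => // /andP[_].
  by case: (children x).
rewrite /net_size big_sumType /=.
(* One half pays for the old gates, each wire becoming at most k + 1 wires; the other half pays for
   the gates [(x, i)], where [x] has at most as many distinct variables as children. *)
rewrite mulnCA mul2n -addnn; apply: (@leq_trans
  (net_size N * k.+1 + net_size N * k.+1)%N); last by rewrite leq_add // leq_mul.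
rewrite /net_size big_distrl /=; apply: leq_add.
  apply: leq_sum => x _; case: ifP => _; first by rewrite size_map leq_pmulr.
  rewrite size_flatten /shape -map_comp sumnE big_map.
  rewrite -sum1_size big_distrl /=; apply: leq_sum => -[y|l] _ //=.
  by rewrite size_map mul1n size_affine_leaves.
apply: (@leq_trans (\sum_(u : gate N * 'I_m)
  (if inr (inr u.2) \in children u.1 then k.+1 else 0))%N).
  apply: leq_sum => -[x i] _ /=.
  case: (inr (inr i) \in _); rewrite ?andbF //.
  by case: ifP => // _; rewrite size_map (size_affine_leaves (inr i)).
rewrite -(pair_bigA _ (fun (x : gate N) (i : 'I_m) =>
  if inr (inr i) \in children x then k.+1 else 0%N)) /=.
apply: leq_sum => x _; rewrite -big_mkcond /=.
rewrite sum_nat_const leq_mul2r; apply/orP; right.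
rewrite cardE -(size_map (fun i => inr (inr i) : gate N + (F + 'I_m))).
apply: uniq_leq_size; first by rewrite map_inj_uniq ?enum_uniq // => i j [].
by move=> u /mapP[i]; rewrite mem_enum => iP ->.
Qed.
End Substitution.

(** * From circuits to nets *)

Section OfCircuit.
Variables (F : fieldType) (m : nat) (c : circuit F m).
Local Notation e := (grel (@cfanin F m c)).

(** Serves to prolong a path up to an input, since [depth_at_most] bounds only such paths. *)
Lemma path_to_input (x : cnode c) :
  exists2 p, path e x p & is_input (clabel (last x p)).
Proof.
elim/circuit_ind: x => x IH; have := c_input x.
case E : (cfanin x) => [|y s] /=; first by exists [::].
have [|p yp py] := IH y; first by rewrite E mem_head.
by exists (y :: p); rewrite //= E mem_head.
Qed.

Variable layer : cnode c -> nat.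
Hypothesis layer_cout : layer (cout c) = 0%N.
Hypothesis layer_fanin : forall x y : cnode c, y \in cfanin x ->
  ~~ is_input (clabel y) -> layer y = (layer x).+1.

Lemma layer_path p : path e (cout c) p ->
  ~~ is_input (clabel (last (cout c) p)) -> layer (last (cout c) p) = size p.
Proof.
elim/last_ind: p => [|p x IH] //; rewrite rcons_path last_rcons size_rcons.
move=> /andP[pp px] nx; rewrite (layer_fanin px nx) IH // -c_input.
by apply: contraL px => /nilP /= ->.
Qed.

Definition circuit_child (x : cnode c) : cnode c + (F + 'I_m) :=
  match clabel x with
  | LConst a => inr (inl a)
  | LVar i => inr (inr i)
  | _ => inl x
  end.

(** The depth bound says nothing about the layers of nodes unreachable from the output, so these
    lose their wires. *)
Definition circuit_children (x : cnode c) :=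
  if connect e (cout c) x then map circuit_child (cfanin x) else [::].

Fact circuit_level_child x y :
  inl y \in circuit_children x -> layer y = (layer x).+1.
Proof.
rewrite /circuit_children; case: ifP => // _ /mapP[z zx]; rewrite /circuit_child.
by case E: (clabel z) => // -[->]; apply: layer_fanin; rewrite ?E.
Qed.

Definition net_of_circuit := Net layer_cout circuit_level_child.
End OfCircuit.

Lemma circuit_computable (F : fieldType) m (c : circuit F m) D p :
  computes c p -> depth_at_most c D -> computable false D (csize c) p.
Proof.
move=> [v hv vp] dD; have [layer [l0 lS lP lf]] := c_layered c.
pose N := net_of_circuit l0 lf.
pose live x := connect (grel (@cfanin F m c)) (cout c) x &&
  ~~ is_input (clabel x).
pose v' (x : gate N) := if live x then v x else gate_op (odd (layer x)) [::].
have v'E x : live x -> v' x = v x by rewrite /v' => ->.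
exists N, v'; split.
- move=> x; rewrite [v' x]/v' /= /circuit_children.
  case: ifP => [/andP[cx nx]|/nandP]; last first.
    case=> [/negbTE ->|] //; case: ifP => // _.
    by rewrite negbK -c_input => /nilP ->.
  rewrite cx -map_comp.
  have E y : y \in cfanin x -> child_val v' (circuit_child y) = v y.
    move=> yx; have cy : connect (grel (@cfanin F m c)) (cout c) y.
      by apply: connect_trans cx _; apply: connect1.
    rewrite /circuit_child; case Ly: (clabel y) => [a|i||] /=.
    - by rewrite hv /gate_value Ly.
    - by rewrite hv /gate_value Ly.
    - by rewrite v'E // /live cy Ly.
    - by rewrite v'E // /live cy Ly.
  rewrite hv /gate_value /gate_op; case Lx: (clabel x) nx => //= _.
    rewrite (negbTE (lS x Lx)) big_map; apply: eq_big_seq => y /E /= -> //.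
  by rewrite (lP x Lx) big_map; apply: eq_big_seq => y /E /= ->.
- by rewrite v'E // /live connect0 c_top.
- move=> x /=; rewrite /circuit_children; case: ifP => // /connectP[q qp xq] ne.
  have nx : ~~ is_input (clabel x).
    by rewrite -c_input; apply: contraNN ne => /nilP ->.
  (* A reachable gate is followed by at least one more wire on the way to an input, which makes the
     bound on its layer strict. *)
  have [[|y p'] xp] := path_to_input x; first by rewrite /= (negbTE nx).
  rewrite xq in xp * => ip; have /= := layer_path l0 lf qp.
  rewrite -xq => ->; last by [].
  have := dD (q ++ y :: p'); rewrite cat_path qp last_cat => /(_ xp ip).
  by rewrite size_cat /= addnS; apply: leq_ltn_trans; rewrite leq_addr.
apply: leq_sum => x _ /=; rewrite /circuit_children; case: ifP => //.
by rewrite size_map.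
Qed.

(** * From nets to circuits *)

Section ToCircuit.
Variables (F : fieldType) (m : nat) (N : net F m) 
  (root_children : children (root N) != [::]).

Definition net_leaves : seq (F + 'I_m) :=
  pmap (fun c : gate N + (F + 'I_m) => if c is inr l then Some l else None)
    (flatten [seq children x | x <- enum (gate N)]).

(** There is a node for each position in [net_leaves], and one more, labelled by the default
    constant 0, which keeps the index type inhabited for [inord]. *)
Local Notation node := (gate N + 'I_(size net_leaves).+1)%type.

Definition leaf_label (l : F + 'I_m) : label F m :=
  match l with inl a => LConst a | inr i => LVar i end.

Definition child_node (c : gate N + (F + 'I_m)) : node :=
  match c with
  | inl x => inl x
  | inr l => inr (inord (index l net_leaves))
  end.

Definition net_label (x : node) : label F m :=
  match x with
  | inl x => if nilp (children x) then LConst (odd (level x))%:R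
             else if odd (level x) then LProd else LSum
  | inr i => leaf_label (nth (inl 0) net_leaves i)
  end.

Definition net_fanin (x : node) : seq node :=
  match x with inl x => map child_node (children x) | inr _ => [::] end.

(** Leaves are placed beyond all gates, so that the rank increases strictly along wires and excludes
    cycles. *)
Definition net_rank (x : node) : nat :=
  match x with inl x => level x | inr _ => (\max_(y : gate N) level y).+1 end.

Lemma net_rank_fanin x y : y \in net_fanin x -> (net_rank x < net_rank y)%N.
Proof.
case: x => [x|i] //= /mapP[[z|l] zx -> /=]; first by rewrite (level_child zx).
by rewrite ltnS leq_bigmax.
Qed.

Fact net_input x : nilp (net_fanin x) = is_input (net_label x).
Proof.
case: x => [x|i] /=; last by case: (nth _ _ _).
by rewrite /nilp size_map; case: ifP => // _; case: ifP.
Qed.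

Fact net_acyclic x y : y \in net_fanin x -> ~~ connect (grel net_fanin) y x.
Proof.
move=> /net_rank_fanin lt_xy; apply/negP => /connectP[p].
have rank_path z : path (grel net_fanin) z p -> (net_rank z <= net_rank (last z p))%N.
  elim: p z => [|u p IH] z //= /andP[/net_rank_fanin zu /IH].
  exact/leq_trans/ltnW.
by move=> /rank_path + xp; rewrite -xp leqNgt lt_xy.
Qed.

Fact net_layered : exists layer : node -> nat,
  [/\ layer (inl (root N)) = 0%N,
      forall x, net_label x = LSum -> ~~ odd (layer x),
      forall x, net_label x = LProd -> odd (layer x) &
      forall x y, y \in net_fanin x -> ~~ is_input (net_label y) ->
        layer y = (layer x).+1].
Proof.
exists (fun x => if x is inl x then level x else 0%N); split.
- exact: level_root.
- by case=> [x|i] //=; case: ifP => // _; case: ifP.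
- by case=> [x|i] /=; [case: ifP => // _; case: ifP | case: (nth _ _ _)].
case=> [x|i] // y /mapP[[z|l] zx -> /=]; first by rewrite (level_child zx).
by case: (nth _ _ _).
Qed.

Fact net_top : net_label (inl (root N)) = LSum.
Proof. by rewrite /= level_root /nilp size_eq0 (negbTE root_children). Qed.

Definition circuit_of_net :=
  Circuit net_input net_acyclic net_layered net_top.

Lemma child_nodeK (x : gate N) l : inr l \in children x ->
  nth (inl 0) net_leaves (inord (index l net_leaves) : 'I_(size net_leaves).+1) = l.
Proof.
move=> lx; rewrite inordK ?nth_index ?ltnS ?index_size //.
rewrite mem_pmap; apply/mapP; exists (inr l) => //.
by apply/flatten_mapP; exists x; rewrite ?mem_enum.
Qed.

Lemma circuit_of_net_computes v : net_valuation false v ->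
  computes circuit_of_net (v (root N)).
Proof.
move=> hv; exists (fun x : node => match x with inl x => v x
  | inr i => leaf_val (nth (inl 0) net_leaves i) end) => // -[x|i].
  rewrite /gate_value /= hv; case: (altP nilP) => [->|ne].
    by rewrite /gate_op /= !big_nil; case: odd; rewrite ?mpolyC1 ?mpolyC0.
  have E : map (child_val v) (children x) = map (fun y : node => match y with
      inl x => v x | inr i => leaf_val (nth (inl 0) net_leaves i) end)
      (net_fanin (inl x)).
    rewrite /= -map_comp; apply/eq_in_map => -[y|l] //= /child_nodeK.
    by move=> ->.
  by rewrite E /gate_op /=; case: odd; rewrite [LHS]big_map.
by rewrite /gate_value /=; case: (nth _ _ _).
Qed.

Lemma circuit_of_net_size : csize circuit_of_net = net_size N.
Proof.
rewrite /csize big_sumType /= [X in (_ + X)%N]big1 // addn0.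
by apply: eq_bigr => x _; rewrite size_map.
Qed.

Lemma circuit_of_net_depth D : net_depth N D -> depth_at_most circuit_of_net D.
Proof.
move=> dD p pp _.
have H x q : path (grel net_fanin) (inl x) q -> (level x <= D)%N ->
    (level x + size q <= D)%N.
  elim: q x => [|y q IH] x /=; first by rewrite addn0.
  move=> /andP[/mapP[u ux ->] yq] _.
  have lx : (level x < D)%N by apply: dD; case: (children x) ux.
  case: u ux yq => [z|l] zx /=.
    by rewrite addnS -addSn -(level_child zx) => /IH; apply; rewrite (level_child zx).
  by case: q {IH} => //= _; rewrite addn1.
have := H _ _ pp; rewrite level_root; apply.
exact: leq0n.
Qed.
End ToCircuit.

Lemma computable_circuit (F : fieldType) m D S (p : {mpoly F[m]}) :
  (0 < D)%N -> computable false D S p ->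
  exists c : circuit F m,
    [/\ computes c p, depth_at_most c D & (csize c <= S.+1)%N].
Proof.
move=> D0 [N [v [hv <- dN sN]]].
have [r0|r0] := eqVneq (children (root N)) [::]; last first.
  exists (circuit_of_net r0); split; first exact: circuit_of_net_computes.
    exact: circuit_of_net_depth.
  by rewrite circuit_of_net_size leqW.
(* A childless root would turn into a constant, whereas the output must be a sum gate. Its value is
   the empty sum 0, recomputed by a sum gate with one wire from the constant 0. *)
exists (@circuit_of_net _ _ (leaf_net (inl 0)) isT); split.
- have -> : v (root N) = 0 by rewrite hv r0 level_root /gate_op /= big_nil.
  apply: (@circuit_of_net_computes _ _ (leaf_net (inl 0)) isT (fun=> 0)) => x.
  by rewrite /gate_op /= big_seq1 mpolyC0.
- by apply: circuit_of_net_depth.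
by rewrite circuit_of_net_size /net_size big_const card_unit.
Qed.

(** * Polynomials in several variables *)

Lemma rmorph_mmap (n : nat) (R : nzRingType) (S T : comNzRingType)
    (rho : {rmorphism S -> T}) (f : R -> S) (h : 'I_n -> S) p :
  rho (mmap f h p) = mmap (rho \o f) (rho \o h) p.
Proof.
rewrite /mmap rmorph_sum; apply: eq_bigr => m _; rewrite rmorphM; congr (_ * _).
by rewrite /mmap1 rmorph_prod; apply: eq_bigr => i _; rewrite rmorphXn.
Qed.

Lemma eq_mmap (n : nat) (R S : nzRingType) (f f' : R -> S) (h h' : 'I_n -> S) :
  f =1 f' -> h =1 h' -> mmap f h =1 mmap f' h'.
Proof.
move=> ef eh p; apply: eq_bigr => m _; rewrite ef; congr (_ * _).
exact: mmap1_eq.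
Qed.

Lemma mmap_id (n : nat) (R : nzRingType) (p : {mpoly R[n]}) :
  mmap (@mpolyC n R) (fun i => 'X_i) p = p.
Proof.
rewrite [RHS]mpolyE; apply: eq_bigr => m _.
by rewrite mmap1_id mul_mpolyC.
Qed.

Section Univariate.
Variables (n : nat) (R : comNzRingType).
Implicit Type p : {mpoly R[n.+1]}.

Definition split_var (T : Type) (h : 'I_n -> T) (y : T) (i : 'I_n.+1) : T :=
  if unlift ord_max i is Some j then h j else y.

Lemma muni_mmap p : muni p =
  mmap (polyC \o @mpolyC n R) (split_var (fun j => ('X_j)%:P) 'X) p.
Proof.
apply: eq_mmap => // i; rewrite /split_var; case: splitP => [j|j] /= ij.
  have -> : i = lift ord_max j by apply: ord_inj; rewrite lift_max -ij.
  by rewrite liftK.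
have -> : i = ord_max by apply: val_inj; rewrite /= ij ord1 addn0.
by rewrite unlift_none.
Qed.

Lemma horner_muni p y : (muni p).[y] =
  mmap (@mpolyC n R) (split_var (fun j => 'X_j) y) p.
Proof.
rewrite muni_mmap -/(horner_eval y _) rmorph_mmap; apply: eq_mmap => [a|i].
  by rewrite /= /horner_eval hornerC.
rewrite /= /horner_eval /split_var; case: unlift => [j|]; first by rewrite hornerC.
by rewrite hornerX.
Qed.

(** A left inverse embeds the coefficients back into n + 1 variables and evaluates the outer
    variable at the last one. *)
Lemma muni_inj : injective (@muni n R).
Proof.
move=> p q pq; suff H p' : (map_poly (mmap (@mpolyC n.+1 R)
    (fun j : 'I_n => 'X_(lift ord_max j))) (muni p')).['X_ord_max] = p'.
  by rewrite -[p]H pq H.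
rewrite -/(horner_eval 'X_ord_max _) muni_mmap.
rewrite (rmorph_mmap (map_poly _)) rmorph_mmap -[RHS]mmap_id.
apply: eq_mmap => [a|i] /=.
  by rewrite map_polyC /horner_eval hornerC /= mmapC.
rewrite /split_var; case: unliftP => [j|] -> /=.
  by rewrite map_polyC /horner_eval hornerC /= mmapX mmap1U.
by rewrite map_polyX /horner_eval hornerX.
Qed.

Lemma coef_muni p i : (muni p)`_i = \sum_(m <- msupp p | m ord_max == i)
  p@_m *: 'X_[[multinom (m (widen_ord (leqnSn n) j)) | j < n]].
Proof.
rewrite muniE coef_sum [RHS]big_mkcond; apply: eq_bigr => m _ /=.
rewrite coefZ coefXn eq_sym; case: eqP => _; first by rewrite mulr1.
by rewrite mulr0.
Qed.

Lemma mdeg_split (m : 'X_{1..n.+1}) : mdeg m =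
  (mdeg [multinom (m (widen_ord (leqnSn n) j)) | j < n] + m ord_max)%N.
Proof.
rewrite !mdegE big_ord_recr /=; congr (_ + _)%N.
by apply: eq_bigr => j _; rewrite mnmE.
Qed.

Lemma size_muni p : (size (muni p) <= msize p)%N.
Proof.
apply/leq_sizeP => i pi; rewrite coef_muni big_seq_cond big1 // => m.
case/andP => /msize_mdeg_lt + /eqP mi; rewrite mdeg_split mi; lia.
Qed.

Lemma msize_coef_muni p i : (msize (muni p)`_i <= msize p)%N.
Proof.
rewrite coef_muni; apply: leq_trans (msize_sum _ _ _) _.
apply/bigmax_leqP_seq => m mp _; apply: leq_trans (msizeZ_le _ _) _.
by rewrite msizeX; have := msize_mdeg_lt mp; rewrite mdeg_split; lia.
Qed.
End Univariate.

(** * Nonvanishing in characteristic zero *)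

Section CharZero.
Variable F : fieldType.
Hypothesis char0 : [pchar F] =i pred0.

Lemma poly_nonroot (p : {poly F}) : p != 0 -> exists k : nat, p.[k%:R] != 0.
Proof.
move=> p0; have [c cP] := interpolation (size p) char0.
case: (altP (@forallP 'I_(size p) (fun k => p.[k%:R] == 0))) => [H|].
  case/eqP: p0; apply/polyP => i; rewrite coef0.
  have [ip|ip] := ltnP i (size p); last by rewrite nth_default.
  rewrite (cP _ idfun) // big1 // => k _.
  by rewrite (eqP (H k)) mulr0.
by rewrite negb_forall => /existsP[k pk]; exists k.
Qed.

(** By induction, some point keeps the leading coefficient in the last variable nonzero; the last
    coordinate is then a natural number avoiding the roots of a univariate polynomial. *)
Lemma mpoly_nonroot n (p : {mpoly F[n]}) : p != 0 -> exists a, p.@[a] != 0.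
Proof.
elim: n p => [|n IH] p p0.
  exists (fun=> 0); move: p0; rewrite (nvar0_mpolyC p) mevalC.
  by apply: contraNneq => ->.
have mp0 : muni p != 0 by rewrite -(muni0 n F) (inj_eq (@muni_inj _ _)).
have [|a lc_a] := IH (lead_coef (muni p)); first by rewrite lead_coef_eq0.
pose q := map_poly (meval a) (muni p).
have [|k qk] := @poly_nonroot q.
  apply: contraNneq lc_a => q0; have : q`_(size (muni p)).-1 = 0.
    by rewrite q0 coef0.
  by rewrite coef_map => /eqP.
exists (split_var a k%:R); suff <- : q.[k%:R] = p.@[split_var a k%:R] by [].
rewrite -(rmorph_nat (meval a)) horner_map horner_muni /= rmorph_mmap.
apply: eq_mmap => [b|i] /=; first by rewrite mevalC.
by rewrite /split_var; case: unlift => [j|]; rewrite ?mevalXU ?rmorph_nat.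
Qed.

(** The derivative of order deg p is the leading coefficient times (deg p)!, a nonzero constant. *)
Lemma derivn_nonroot (A : idomainType) (iota : {rmorphism F -> A}) (p : {poly A}) x :
  p != 0 -> exists j, p^`(j).[x] != 0.
Proof.
move=> p0; exists (size p).-1.
have -> : p^`((size p).-1) = (lead_coef p *+ (size p).-1`!)%:P.
  apply/polyP => i; rewrite coef_derivn coefC; case: i => [|i].
    by rewrite addn0 ffactnn.
  rewrite nth_default ?mul0rn // addnS -addSn prednK ?size_poly_gt0 //.
  by rewrite leq_addr.
rewrite hornerC -mulr_natr mulf_neq0 ?lead_coef_eq0 //.
rewrite -(rmorph_nat iota) fmorph_eq0.
by move/pcharf0P: char0 => ->; rewrite -lt0n fact_gt0.
Qed.

End CharZero.

Lemma size_polyM_leqS (A : nzSemiRingType) (p q : {poly A}) i j :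
  (size p <= i.+1)%N -> (size q <= j.+1)%N -> (size (p * q)%R <= (i + j).+1)%N.
Proof. by have := size_polyMleq p q; lia. Qed.

Lemma size_polyX_leqS (A : nzSemiRingType) (p : {poly A}) i m :
  (size p <= i.+1)%N -> (size (p ^+ m)%R <= (i * m).+1)%N.
Proof.
move=> pi; elim: m => [|m IH]; first by rewrite expr0 size_poly1.
by rewrite exprS mulnS; apply: size_polyM_leqS.
Qed.

Lemma size_polyD_leq (A : nzSemiRingType) (p q : {poly A}) k :
  (size p <= k)%N -> (size q <= k)%N -> (size (p + q)%R <= k)%N.
Proof. by move=> pk qk; rewrite (leq_trans (size_polyD _ _)) // geq_max pk. Qed.

(** * Homotheties and the Newton map *)

Section Homothety.
Variables (F : fieldType) (n : nat) (a : 'I_n -> F).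
Local Notation A := {mpoly F[n]}.

(* The homothety of ratio [t] centred at [a]. *)
Definition homothety : A -> {poly A} :=
  mmap (polyC \o @mpolyC n F)
    (fun i => (a i)%:MP%:P + 'X * ('X_i - (a i)%:MP)%:P).

HB.instance Definition _ := GRing.RMorphism.on homothety.

Lemma homothetyC c : homothety c%:MP = c%:MP%:P.
Proof. by rewrite /homothety mmapC. Qed.

Lemma horner_homothety x p : (homothety p).[x] =
  mmap (@mpolyC n F) (fun i => (a i)%:MP + x * ('X_i - (a i)%:MP)) p.
Proof.
rewrite -/(horner_eval x _) rmorph_mmap; apply: eq_mmap => [c|i] /=.
  by rewrite /horner_eval hornerC.
by rewrite /horner_eval hornerD hornerM !hornerC hornerX.
Qed.

Lemma homothety1 p : (homothety p).[1] = p.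
Proof.
rewrite horner_homothety -[RHS]mmap_id; apply: eq_mmap => // i.
by rewrite mul1r addrC subrK.
Qed.

Lemma homothety0 p : (homothety p).[0] = p.@[a]%:MP.
Proof.
rewrite horner_homothety rmorph_mmap; apply: eq_mmap => // i.
by rewrite mul0r addr0.
Qed.

Lemma size_homothety p : (size (homothety p) <= msize p)%N.
Proof.
apply: leq_trans (size_sum _ _ _) _; apply/bigmax_leqP_seq => m mp _.
apply: leq_trans (msize_mdeg_lt mp).
apply: (size_polyM_leqS (i := 0) (j := mdeg m)); first exact: size_polyC_leq1.
rewrite mdegE /mmap1; elim/big_rec2: _ => [|i u k _ IH].
  by rewrite size_poly1.
apply: size_polyM_leqS => //; rewrite -[X in (_ <= X.+1)%N]mul1n.
apply: size_polyX_leqS; apply: size_polyD_leq.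
  by rewrite (leq_trans (size_polyC_leq1 _)).
rewrite (size_polyM_leqS (i := 1) (j := 0)) ?size_polyX //.
exact: size_polyC_leq1.
Qed.
End Homothety.

Section NewtonMap.
Variables (R : idomainType) (c y : R) (p : {poly R}).

(** The simplified Newton iteration, recentred at [y]: [c] stands for a fixed inverse slope, and [x]
    is a fixed point when [x + y] is a root of [p]. *)
Definition newton_map := 'X - c%:P * (p \Po ('X + y%:P)).

Lemma horner_newton_map x : newton_map.[x] = x - c * p.[x + y].
Proof.
rewrite hornerD hornerN hornerM hornerX hornerC horner_comp hornerD hornerX.
by rewrite hornerC.
Qed.

Lemma coef0_newton_map : newton_map`_0 = - (c * p.[y]).
Proof. by rewrite -horner_coef0 horner_newton_map add0r add0r. Qed.

Lemma coef1_newton_map : newton_map`_1 = 1 - c * p^`().[y].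
Proof.
have -> : newton_map`_1 = newton_map^`()`_0 by rewrite coef_deriv.
rewrite -horner_coef0 derivB derivX deriv_mulC deriv_comp derivD derivX derivC.
by rewrite addr0 mulr1 !hornerE horner_comp !hornerE.
Qed.

Lemma size_newton_map k : (0 < k)%N -> (size p <= k.+1)%N ->
  (size newton_map <= k.+1)%N.
Proof.
move=> k0 pk; apply: size_polyD_leq; first by rewrite size_polyX.
rewrite size_polyN (size_polyM_leqS (i := 0)) ?size_polyC_leq1 //.
by rewrite size_comp_poly2 ?size_XaddC.
Qed.
End NewtonMap.

(** * An explicit formula for the root *)

Section RootFormula.
Variables (F : fieldType) (n r d : nat) (P : {mpoly F[n.+1]}) (f : {mpoly F[n]}).
Hypothesis char0 : [pchar F] =i pred0.
Hypothesis P_size : (msize P <= r.+1)%N.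
Hypothesis r_gt0 : (0 < r)%N.
Hypothesis f_size : (msize f <= d.+1)%N.
Hypothesis P_root : (muni P).[f] = 0.

Local Notation A := {mpoly F[n]}.
Local Notation M := (2 * d).+3.
Local Notation D := (r * M).+1.

(** The least order of a derivative in y that does not vanish at [f] is positive, and [j] is its
    predecessor. *)
Lemma simple_root : P != 0 ->
  exists j, (muni P)^`(j).[f] = 0 /\ (muni P)^`(j.+1).[f] != 0.
Proof.
move=> P_neq0; have mP : muni P != 0 by rewrite -(muni0 n F) (inj_eq (@muni_inj _ _)).
have ex := derivn_nonroot char0 (@mpolyC n F) f mP.
case: (ex_minnP ex) => -[|j] jP jmin; first by rewrite /= P_root eqxx in jP.
exists j; split=> //; apply/eqP; apply: contraTT (ltnSn j) => /jmin.
by rewrite -leqNgt.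
Qed.

(* [P (l x + (1 - l) a, j)] *)
Definition scaled_at (a : 'I_n -> F) (l j : nat) : A :=
  mmap (@mpolyC n F)
    (affine_subst l (split_var inr (inl j%:R)) (fun i => a i * (1 - l%:R))) P.

(** For a natural ratio [l] the homothety is an affine substitution of the kind that nets realise by
    parallel wires. *)
Lemma scaled_atE a l j :
  scaled_at a l j = (homothety a (muni P).[j%:R]).[l%:R].
Proof.
rewrite horner_muni horner_homothety rmorph_mmap; apply: eq_mmap => [c|i] /=.
  by rewrite mmapC.
rewrite /affine_subst /split_var; case: unlift => [k|]; last first.
  by rewrite !rmorph_nat.
rewrite mmapX mmap1U mpolyCM mpolyCB mpolyC1 mpolyC_nat -mulr_natl.
by ring.
Qed.

Variables (a : 'I_n -> F) (j : nat).
Let Q := (muni P)^`(j).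
Hypothesis Q_root : Q.[f] = 0.
Let q := (Q^`().[f]).@[a].
Hypothesis q_neq0 : q != 0.

Let y0 := f.@[a].
Let g := homothety a f - y0%:MP%:P.
Let Qa := map_poly (homothety a) Q.
Let phi := newton_map (q^-1)%:MP%:P y0%:MP%:P Qa.

Lemma phi_fixed : phi.[g] = g.
Proof.
by rewrite horner_newton_map subrK horner_map Q_root rmorph0 mulr0 subr0.
Qed.

Lemma map_homothety_coef0 (p : {poly A}) :
  ((map_poly (homothety a) p).[y0%:MP%:P])`_0 = (p.[f]).@[a]%:MP.
Proof.
rewrite -homothety0 -horner_coef0 -!/(horner_eval 0 _) -horner_map.
rewrite -[homothety a _]horner_map -[RHS]horner_map /=; congr horner.
by rewrite /horner_eval hornerC homothety0.
Qed.

(** Only two coefficients have weight below 2. At z^0 t^0 it vanishes because [f] is a root of [Q],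
    at z^1 t^0 because the slope there is normalised by [q^-1]. *)
Lemma phi_wge : wge 2 phi.
Proof.
have p0 : phi`_0`_0 = 0.
  rewrite coef0_newton_map coefN coefCM map_homothety_coef0 Q_root.
  by rewrite meval0 mpolyC0 mulr0 oppr0.
have p1 : phi`_1`_0 = 0.
  rewrite coef1_newton_map deriv_map coefB coef1 coefCM map_homothety_coef0.
  by rewrite -mpolyCM mulVf // mpolyC1 subrr.
by move=> [|[|i]] [|b] //; lia.
Qed.

Lemma g_ordge : ordge 1 g.
Proof.
move=> [|//] _; rewrite /g -horner_coef0 hornerD hornerN hornerC homothety0.
by rewrite subrr.
Qed.

Lemma size_phi : (size phi <= r.+1)%N.
Proof.
apply: size_newton_map => //.
apply/leq_sizeP => i ri.
rewrite coef_map /= coef_derivn nth_default ?mul0rn ?rmorph0 //.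
by rewrite (leq_trans (size_muni _)) // (leq_trans P_size) // (leq_trans ri) ?leq_addl.
Qed.

Lemma size_horner_phi k : (size phi.[k%:R] <= r.+1)%N.
Proof.
have cst c : (size (c%:P : {poly A}) <= r.+1)%N.
  by rewrite (leq_trans (size_polyC_leq1 _)).
rewrite horner_newton_map; apply: size_polyD_leq; first by rewrite -polyC_natr.
rewrite size_polyN (size_polyM_leqS (i := 0)) ?size_polyC_leq1 //.
rewrite -polyC_natr -polyCD horner_coef (leq_trans (size_sum _ _ _)) //.
apply/bigmax_leqP => i _; rewrite -polyC_exp -[r]addn0.
apply: size_polyM_leqS; last exact: size_polyC_leq1.
rewrite coef_map (leq_trans (size_homothety _ _)) // coef_derivn.
by rewrite -scaler_nat (leq_trans (msizeZ_le _ _)) // (leq_trans (msize_coef_muni _ _)).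
Qed.

(** At z = k the argument k + [y0] of [Qa] is a scalar, so [derivn_interpolation] reduces [Qa] to
    values of [P] at natural numbers. *)
Lemma horner_phi_interpolation : exists c : nat -> nat -> F, forall k l,
  phi.[k%:R].[l%:R] =
  k%:R%:MP + \sum_(i < r.+1) c k i *: scaled_at a l i.
Proof.
have [c cP] := derivn_interpolation r.+1 j char0.
exists (fun k i => - (q^-1 * c (k%:R + y0) i)) => k l.
have sP : (size (muni P) <= r.+1)%N by apply: leq_trans (size_muni _) _.
rewrite horner_newton_map hornerD hornerN hornerM hornerC.
have -> : k%:R + y0%:MP%:P = (k%:R + y0)%:MP%:P :> {poly A}.
  by rewrite mpolyCD polyCD mpolyC_nat polyC_natr.
rewrite -(homothetyC a) horner_map /= (cP _ (@mpolyC n F)) // rmorph_sum horner_sum.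
rewrite -polyC_natr hornerC mpolyC_nat; congr (_ + _); rewrite mulr_sumr -sumrN.
apply: eq_bigr => i _; rewrite rmorphM /= homothetyC hornerM hornerC.
by rewrite -scaled_atE -mul_mpolyC mpolyCN mpolyCM; ring.
Qed.

Lemma root_formula_at : exists (gamma : nat -> nat -> nat -> F) (c : nat -> nat -> F),
  f = y0%:MP + \sum_(m < M) \sum_(k < D) \sum_(l < D) gamma m k l *:
    (k%:R%:MP + \sum_(i < r.+1) c k i *: scaled_at a l i) ^+ m.+1.
Proof.
have [c cP] := horner_phi_interpolation.
have [e eP] := lagrange_inversion (@mpolyC n F) char0 d
  phi_wge phi_fixed g_ordge.
have [t tP] := interpolation D char0.
(* Here [e m] is the Lagrange coefficient, [t m k] extracts z^m from the values at z = k, and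
   [t i l] extracts t^i from those at t = l; summing over i up to d evaluates [g] at t = 1. The
   number [D] of nodes suffices since these powers of [phi] have degree at most r M. *)
exists (fun m k l => e m * t m k * \sum_(i < d.+1) t i l), c.
have size_g : (size g <= d.+1)%N.
  apply: size_polyD_leq; first exact: leq_trans (size_homothety _ _) f_size.
  by rewrite size_polyN (leq_trans (size_polyC_leq1 _)).
have g_coef i : (i < d.+1)%N -> g`_i =
    \sum_(m < M) \sum_(k < D) \sum_(l < D) (e m * t m k * t i l) *:
      phi.[k%:R].[l%:R] ^+ m.+1.
  move=> id; have /eqP := eP i id; rewrite coefB subr_eq0 => /eqP ->.
  rewrite coef_sum; apply: eq_bigr => m _; rewrite coefCM.
  rewrite (tP _ (polyC \o @mpolyC n F)); first last.
  - by have := ltn_ord m; nia.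
  - by apply: leq_trans (size_polyX_leqS m.+1 size_phi) _; rewrite ltnS leq_mul.
  rewrite coef_sum mulr_sumr; apply: eq_bigr => k _; rewrite /= coefCM.
  rewrite horner_exp (tP _ (@mpolyC n F)); first last.
  - by nia.
  - apply: leq_trans (size_polyX_leqS m.+1 (size_horner_phi k)) _.
    by rewrite ltnS leq_mul.
  rewrite !mulr_sumr; apply: eq_bigr => l _; rewrite horner_exp.
  by rewrite -mul_mpolyC !mpolyCM; ring.
have -> : f = y0%:MP + g.[1].
  by rewrite /g hornerD hornerN hornerC homothety1 addrC subrK.
congr (_ + _); rewrite (horner_coef_wide _ size_g).
under eq_bigr => i _ do rewrite expr1n mulr1 g_coef //.
rewrite exchange_big /=; apply: eq_bigr => m _.
rewrite exchange_big /=; apply: eq_bigr => k _.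
rewrite exchange_big /=; apply: eq_bigr => l _.
by rewrite mulr_sumr scaler_suml -cP; apply: eq_bigr.
Qed.

End RootFormula.

(** * The circuit of a root *)

Lemma comp_mpoly_rcons (F : fieldType) n (P : {mpoly F[n.+1]}) (f : {mpoly F[n]}) :
  P \mPo [tuple of rcons [tuple 'X_i | i < n] f] = (muni P).[f].
Proof.
rewrite horner_muni; apply: eq_mmap => // i; rewrite (tnth_nth 0) nth_rcons.
rewrite size_tuple /split_var; case: unliftP => [k|] ->.
  by rewrite lift_max ltn_ord -tnth_nth tnth_mktuple.
by rewrite /= ltnn eqxx.
Qed.

Lemma csize_gt0 (F : fieldType) m (c : circuit F m) : (0 < csize c)%N.
Proof.
rewrite /csize (bigD1 (cout c)) //= addn_gt0 lt0n.
by have := c_input (cout c); rewrite c_top /nilp => /negbT ->.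
Qed.

(** [S1] pays for one substituted copy of P, [S2] for a linear combination of such copies, [S3] for
    its power with a scalar factor and a new sum root; the rest is the triple sum. *)
Definition root_circuit_size (s r d : nat) : nat :=
  let M := (2 * d).+3 in
  let D := (r * M).+1 in
  let S1 := (s * (2 * D))%N in
  let S2 := (1 + r.+1 * (2 * (S1 * S1.+2)))%N in
  let S3 := (S2 + M + 3)%N in
  (1 + M * (2 * (1 + D * (2 * (1 + D * (2 * S3)))))).

(** The three extra layers come from the affine substitution, the power, and the outer sum. Linear
    combinations merge into existing sum gates, and the scalar [gamma m k l] joins the product gate
    of the power. *)
Lemma computable_root (F : fieldType) (n r s Delta d : nat)
    (P : {mpoly F[n.+1]}) (f : {mpoly F[n]}) :
  [pchar F] =i pred0 -> P != 0 -> (msize P <= r.+1)%N -> (0 < r)%N ->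
  (0 < Delta)%N -> computable false Delta s P ->
  (msize f <= d.+1)%N -> (muni P).[f] = 0 ->
  computable false (Delta + 3) (root_circuit_size s r d) f.
Proof.
move=> char0 P0 Pr r0 Delta0 cP fd Pf; rewrite /root_circuit_size.
set M := (2 * d).+3; set D := (r * M).+1; set S1 := (s * (2 * D))%N.
set S2 := (1 + r.+1 * _)%N; set S3 := (S2 + M + 3)%N.
have [j [Q0 Q1]] := simple_root char0 Pf P0.
have [a qa] := mpoly_nonroot char0 Q1.
have [gamma [c ->]] := root_formula_at char0 Pr r0 fd Q0 qa.
have zero k : computable false (k + 3) 1 (0 : {mpoly F[n]}).
  by rewrite -(mpolyC0 n); apply: computableW (computable_leaf _ (inl 0)); lia.
apply: computable_sum_ord => [|m].
  by apply: computableW (computable_leaf _ (inl _)); lia.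
rewrite -[X in computable _ _ _ X]add0r.
apply: computable_sum_ord => // k.
rewrite -[X in computable _ _ _ X]add0r.
apply: computable_sum_ord => // l.
rewrite -mul_mpolyC /S3 (_ : (S2 + M + 3 = (2 * 1 + (S2 + M)).+1)%N); last by lia.
rewrite addn3; apply: (@computable_up _ _ true).
rewrite addnC mulrC; apply: computableM; last first.
  by apply: computableW (computable_leaf _ (inl _)); lia.
apply: (@computableW _ _ _ Delta.+2 _ (S2 + m.+1)) => //.
  by rewrite leq_add2l.
apply: computable_exp; apply: computable_sum_ord => [|i].
  by apply: computableW (computable_leaf _ (inl _)).
apply: computableZ => //.
apply: computableW (computable_subst _ _ _ cP) => //.
by rewrite leq_mul2l leq_mul2l ltn_ord !orbT.
Qed.

Lemma root_size_bound : exists K, forall s r d,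
  (0 < s)%N -> (0 < r)%N -> (0 < d)%N ->
  (root_circuit_size s r d < (K * (s * r * d)) ^ 6)%N.
Proof.
exists 16 => s r d s0 r0 d0; rewrite /root_circuit_size -add1n addnA.
set M := (2 * d).+3; set D := (r * M).+1; set S1 := (s * (2 * D))%N.
set S2 := (1 + r.+1 * _)%N; set S3 := (S2 + M + 3)%N.
set y := (s * r * d)%N; set x := (16 * y)%N.
have y0 : (0 < y)%N by rewrite !muln_gt0 s0 r0.
have x0 : (0 < x)%N by rewrite muln_gt0.
have rdy : (r * d <= y)%N by rewrite /y -mulnA leq_pmull.
have ry : (r <= y)%N by apply: leq_trans rdy; rewrite leq_pmulr.
have dy : (d <= y)%N by apply: leq_trans rdy; rewrite leq_pmull.
(* Of the factor 16, a share 14 covers the length of a sum and the remaining 2 absorbs the additive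
   constants; each enclosing sum thus costs one factor [x]. *)
have step a b B : (0 < B)%N -> (a <= 14 * y)%N -> (b <= B)%N ->
    (2 + a * b <= x * B)%N.
  move=> B0 ay bB; apply: (@leq_trans (2 + 14 * y * B)).
    by rewrite leq_add2l leq_mul.
  by rewrite /x; have := leq_mul y0 B0; nia.
have D6 : (D <= 6 * (r * d))%N by rewrite /D /M; nia.
have S1y : (S1 <= 12 * y)%N by rewrite /S1 /y; nia.
have SS : (S1 * S1.+2 <= x ^ 2)%N.
  by rewrite expnS expn1; apply: leq_mul; rewrite /x; lia.
have S3x : (S3 <= x ^ 3)%N.
  have X0 : (0 < x ^ 2)%N by rewrite expn_gt0 x0.
  rewrite /S3 /S2 (expnS x 2); move: (x ^ 2)%N (S1 * S1.+2)%N X0 SS => X b X0 bX.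
  apply: (@leq_trans (1 + 4 * y * X + 5 * y + 3)); last first.
    by rewrite /x; have := leq_mul y0 X0; nia.
  rewrite leq_add2r; apply: leq_add; last by rewrite /M; lia.
  by rewrite leq_add2l mulnA leq_mul //; lia.
have D2 : (2 * D <= 14 * y)%N by lia.
have M2 : (2 * M <= 14 * y)%N by rewrite /M; lia.
have xk k : (0 < x ^ k)%N by rewrite expn_gt0 x0.
have T1 : (1 + D * (2 * S3) <= x ^ 4)%N.
  by rewrite mulnA [(D * 2)%N]mulnC ltnW // (expnS x 3); apply: step.
have T2 : (1 + D * (2 * (1 + D * (2 * S3))) <= x ^ 5)%N.
  by rewrite [(D * (2 * (1 + _)))%N]mulnA [(D * 2)%N]mulnC ltnW //
     (expnS x 4); apply: step.
by rewrite mulnA [(M * 2)%N]mulnC (expnS x 5); apply: step.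
Qed.

Theorem theorem2p4 :
  exists (C : nat) (e : nat -> nat), bigO_sqrt e /\
  forall (F : fieldType) (n r s Delta d : nat)
         (P : {mpoly F[n.+1]}) (f : {mpoly F[n]}),
    [pchar F] =i pred0 ->
    (0 < n)%N ->
    P != 0 ->
    (msize P <= r.+1)%N ->
    (exists c : circuit F n.+1,
       [/\ computes c P, csize c = s & depth_at_most c Delta]) ->
    (msize f <= d.+1)%N ->
    P \mPo [tuple of rcons [tuple 'X_i | i < n] f] = 0 ->
    exists c : circuit F n,
      [/\ computes c f,
          depth_at_most c (Delta + 3) &
          (csize c <= C * (s * r * n) ^ 10 * d ^ e d)%N].
Proof.
have [K sizeP] := root_size_bound.
(* The size bound contains d^6, and a constant exponent is O(sqrt d) once it is 0 at d = 0, as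
   [bigO_sqrt] demands. The two added to K^6 cover the constant [f] of the case d = 0, which takes a
   circuit of size at most 2. *)
exists (K ^ 6).+2, (fun d => if d == 0%N then 0%N else 6%N); split.
  by exists 6%N => d; case: eqP => [->|/eqP d0] //; rewrite leq_pmulr // lt0n.
move=> F n r s Delta d P f char0 n0 P0 Pr [c [cP cs cD]] fd; rewrite comp_mpoly_rcons.
move=> Pf.
have s0 : (0 < s)%N by rewrite -cs csize_gt0.
(* For r = 0 the polynomial [P] would be a constant, and its vanishing at [f] would make it zero. *)
have r0 : (0 < r)%N.
  rewrite lt0n; apply: contraNneq P0 => r0; move: Pf; rewrite r0 in Pr.
  rewrite (msize1_polyC Pr) muniC hornerC => /eqP; rewrite mpolyC_eq0 => /eqP ->.
  by rewrite mpolyC0.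
have Delta0 : (0 < Delta)%N.
  have [[|x p] pp ip] := path_to_input (cout c); first by rewrite /= c_top in ip.
  exact: leq_trans (cD _ pp ip).
have srn0 : (0 < s * r * n)%N by rewrite !muln_gt0 s0 r0.
have [d0|d0] := posnP d.
  rewrite d0 in fd *; rewrite (msize1_polyC fd).
  have [||c' [? ? cs']] := @computable_circuit F n (Delta + 3) 1 (f@_0)%:MP.
  - by rewrite addn3.
  - by apply: computableW (computable_leaf _ (inl _)); rewrite ?addn3.
  exists c'; split=> //; apply: leq_trans cs' _; rewrite expn0 muln1 -[2%N]muln1.
  by rewrite leq_mul // expn_gt0 srn0.
have := computable_root char0 P0 Pr r0 Delta0 (circuit_computable cP cD) fd Pf.
move=> /computable_circuit [|c' [? ? cs']]; first by rewrite addn3.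
exists c'; split=> //; apply: leq_trans cs' _; rewrite cs.
apply: leq_trans (sizeP _ _ _ s0 r0 d0) _.
rewrite (expnMn K) (expnMn (s * r)) mulnA leq_mul // leq_mul //.
  exact: leqW (leqnSn _).
apply: (@leq_trans ((s * r * n) ^ 6)); last by rewrite leq_pexp2l.
by rewrite leq_exp2r // leq_pmulr.
Qed.
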